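(* Let $n\ge1$. Every infinite $n$-dependent field $K$ is Artin-Schreier closed; that is, if $K$ has characteristic $p>0$ then $\{x^p-x: x\in K\}=K$.
   Context: A field here is considered as a first-order structure (in the language of rings, possibly expanded by additional structure); it is $n$-dependent if its complete theory is. A formula $\psi(\bar y_0,\dots,\bar y_{n-1};\bar x)$ has the $n$-independence property (IP$_n$) if there exist, in some model of the theory, parameters $(\bar a^j_i:i\in\omega,j<n)$ and $(\bar b_I:I\subseteq\omega^n)$ with $\psi(\bar a^0_{i_0},\dots,\bar a^{n-1}_{i_{n-1}};\bar b_I)$ true iff $(i_0,\dots,i_{n-1})\in I$; a theory is $n$-dependent if no formula has IP$_n$. A field of characteristic $p>0$ is Artin-Schreier closed if it has no proper extension $K(a)$ with $a^p-a\in K$, equivalently $\wp(K)=K$ where $\wp(x)=x^p-x$ (fields of characteristic $0$ are trivially Artin-Schreier closed). *)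

(* Defs.v *)
From mathcomp Require Import all_boot all_order all_algebra all_field.
From mathcomp Require Import boolp classical_sets cardinality.

Set Implicit Arguments.
Unset Strict Implicit.
Unset Printing Implicit Defensive.

Import GRing.Theory.

Local Open Scope classical_set_scope.
Local Open Scope ring_scope.

(* One-sorted first-order languages; constants are 0-ary function symbols. *)
Record language := Language {
  fsym : Type;
  fsym_arity : fsym -> nat;
  rsym : Type;
  rsym_arity : rsym -> nat }.

Record interpretation (L : language) (D : Type) := Interpretation {
  fun_interp : forall f : fsym L, ('I_(fsym_arity f) -> D) -> D;
  rel_interp : forall r : rsym L, ('I_(rsym_arity r) -> D) -> Prop }.

Record structure (L : language) := Structure {
  carrier :> Type;
  interp : interpretation L carrier }.

(* Terms and formulas with free variables in V; in Forall the variable None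
   is the bound one.  Semantics is in Prop and read classically, so the other
   connectives and the existential quantifier are definable. *)
Inductive term (L : language) (V : Type) : Type :=
| Var of V
| App (f : fsym L) of 'I_(fsym_arity f) -> term L V.

Inductive formula (L : language) (V : Type) : Type :=
| Falsum
| Equal of term L V & term L V
| Rel (r : rsym L) of 'I_(rsym_arity r) -> term L V
| Implies of formula L V & formula L V
| Forall of formula L (option V).

Fixpoint eval (L : language) (M : structure L) (V : Type) (v : V -> M)
    (t : term L V) : M :=
  match t with
  | Var x => v x
  | App f ts => fun_interp (interp M) (fun i => eval v (ts i))
  end.

Fixpoint sat (L : language) (M : structure L) (V : Type) (v : V -> M)
    (phi : formula L V) {struct phi} : Prop :=
  match phi with
  | Falsum => False
  | Equal t u => eval v t = eval v u
  | Rel r ts => rel_interp (interp M) (fun i => eval v (ts i))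
  | Implies phi1 phi2 => sat v phi1 -> sat v phi2
  | Forall phi1 => forall x : M, sat (fun o : option V => oapp v x o) phi1
  end.

Definition sentence (L : language) := formula L void.

Definition holds (L : language) (M : structure L) (phi : sentence L) : Prop :=
  sat (fun x : void => match x return M with end) phi.

Definition models (L : language) (M : structure L) (T : set (sentence L)) :=
  forall phi, T phi -> holds M phi.

Definition complete_theory (L : language) (M : structure L) :
  set (sentence L) := [set phi | holds M phi].

(* The variables of psi(y_0, ..., y_(n-1); x), where y_j is a tuple of d j
   variables and x a tuple of e variables. *)
Definition block_var (n : nat) (d : 'I_n -> nat) (e : nat) : Type :=
  ({j : 'I_n & 'I_(d j)} + 'I_e)%type.

Definition block_assign (D : Type) (n : nat) (d : 'I_n -> nat) (e : nat)
    (y : forall j : 'I_n, 'I_(d j) -> D) (x : 'I_e -> D)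
    (z : block_var d e) : D :=
  match z with
  | inl u => y (tag u) (tagged u)
  | inr k => x k
  end.

Definition has_IP (L : language) (T : set (sentence L)) (n : nat)
    (d : 'I_n -> nat) (e : nat) (psi : formula L (block_var d e)) : Prop :=
  exists M : structure L, models M T /\
  exists (a : forall j : 'I_n, nat -> 'I_(d j) -> M)
         (b : set ('I_n -> nat) -> 'I_e -> M),
  forall (I : set ('I_n -> nat)) (i : 'I_n -> nat),
    sat (block_assign (fun j => a j (i j)) (b I)) psi <-> I i.

Definition n_dependent_theory (L : language) (n : nat)
    (T : set (sentence L)) : Prop :=
  forall (d : 'I_n -> nat) (e : nat) (psi : formula L (block_var d e)),
    ~ has_IP T psi.

Definition n_dependent (L : language) (n : nat) (M : structure L) : Prop :=
  n_dependent_theory n (complete_theory M).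

Definition lang_sum (L1 L2 : language) : language := {|
  fsym := (fsym L1 + fsym L2)%type;
  fsym_arity := fun f =>
    match f with inl f1 => fsym_arity f1 | inr f2 => fsym_arity f2 end;
  rsym := (rsym L1 + rsym L2)%type;
  rsym_arity := fun r =>
    match r with inl r1 => rsym_arity r1 | inr r2 => rsym_arity r2 end |}.

Definition interp_sum (L1 L2 : language) (D : Type)
    (S1 : interpretation L1 D) (S2 : interpretation L2 D) :
    interpretation (lang_sum L1 L2) D :=
  @Interpretation (lang_sum L1 L2) D
    (fun f => match f return ('I_(@fsym_arity (lang_sum L1 L2) f) -> D) -> D with
              | inl f1 => fun_interp S1 (f := f1)
              | inr f2 => fun_interp S2 (f := f2)
              end)
    (fun r => match r return ('I_(@rsym_arity (lang_sum L1 L2) r) -> D) -> Prop with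
              | inl r1 => rel_interp S1 (r := r1)
              | inr r2 => rel_interp S2 (r := r2)
              end).

Inductive ring_fsym := RZero | ROne | ROpp | RAdd | RMul.

Definition ring_fsym_arity (f : ring_fsym) : nat :=
  match f with RZero => 0 | ROne => 0 | ROpp => 1 | RAdd => 2 | RMul => 2 end.

Definition ring_language : language := {|
  fsym := ring_fsym;
  fsym_arity := ring_fsym_arity;
  rsym := void;
  rsym_arity := fun r => match r with end |}.

Definition ring_interp (K : fieldType) : interpretation ring_language K :=
  @Interpretation ring_language K
    (fun f => match f return ('I_(ring_fsym_arity f) -> K) -> K with
              | RZero => fun _ => 0
              | ROne => fun _ => 1
              | ROpp => fun x => - x ord0
              | RAdd => fun x => x ord0 + x ord_max
              | RMul => fun x => x ord0 * x ord_max
              end)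
    (fun r => match r with end).

(* The field K, expanded by the additional structure S in the language L. *)
Definition field_structure (K : fieldType) (L : language)
    (S : interpretation L K) : structure (lang_sum ring_language L) :=
  Structure (interp_sum (ring_interp K) S).

(* Since such an a is algebraic over K, it suffices to let the ambient
   extension E of K(a) range over finite ones; 1%VS is the image of K in E.
   In characteristic 0 the condition is vacuous. *)
Definition artin_schreier_closed (K : fieldType) : Prop :=
  forall p : nat, p \in [pchar K] ->
  forall (E : fieldExtType K) (a : E),
    a ^+ p - a \in 1%VS -> <<1; a>>%VS = 1%VS.

(* Main.v *)
(* In characteristic p let P(x) = x ^+ p - x, and choose c in K whose conjugates
   c ^+ (p ^ j), j < D, are distinct.  Modulo the additive group P(K) every
   element is congruent to its p-th power, so for g = c ^+ (p ^ D) and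
   t = \sum_j e_j ^+ (p ^ (D - j)),
     g ^+ i * t = \sum_j (e_j * c ^+ (i * p ^ j)) ^+ (p ^ (D - j))
                = \sum_j e_j * (c ^+ (p ^ j)) ^+ i   mod P(K),
   and the right-hand sides, i < D, can be prescribed arbitrarily since the
   Vandermonde matrix of the c ^+ (p ^ j) is invertible.  If w is not in P(K),
   prescribing the values 0 and w produces every subset of {0, ..., D - 1} as
   {i | g ^+ i * t is not in P(K)}.  With D = m ^ n and i written in base m,
   g ^+ i is a product of n factors, each depending on one digit: this is a
   pattern of size m for IP_n.  An ultrapower of K merges the patterns of all
   sizes into an infinite one. *)
Require Import Defs.
From mathcomp Require Import all_boot all_order all_algebra all_field.
From mathcomp Require Import boolp classical_sets cardinality filter.

Set Implicit Arguments.
Unset Strict Implicit.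
Unset Printing Implicit Defensive.

Import GRing.Theory.

Local Open Scope classical_set_scope.
Local Open Scope ring_scope.

(** * Ultrapowers and the theorem of Łoś *)

Section Ultrapower.
Variables (L : language) (M : structure L) (T : Type) (G : set_system T).
Hypothesis GU : UltraFilter G.

Let GP : ProperFilter G := ultra_proper.

Definition ultra_class (f : T -> M) : set (T -> M) :=
  [set g | \forall t \near G, f t = g t].

(** The elements are the classes themselves, as subsets of [T -> M], so that agreement on a large
    set becomes Leibniz equality, which [sat] demands of [Equal]. *)
Definition ultrapower_type : Type :=
  {A : set (T -> M) | exists f, A = ultra_class f}.

Definition ultra_pi (f : T -> M) : ultrapower_type :=
  exist _ (ultra_class f) (ex_intro _ f erefl).

Definition ultra_repr (u : ultrapower_type) : T -> M :=
  projT1 (cid (proj2_sig u)).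

Definition ultrapower : structure L := Structure (Interpretation
  (fun f args => ultra_pi (fun t =>
     fun_interp (interp M) (f := f) (fun i => ultra_repr (args i) t)))
  (fun r args => \forall t \near G,
     rel_interp (interp M) (r := r) (fun i => ultra_repr (args i) t))).

Lemma ultra_reprK (u : ultrapower_type) : ultra_pi (ultra_repr u) = u.
Proof.
apply: eq_sig_hprop => [A|]; first exact: Prop_irrelevance.
rewrite /ultra_repr /=.
by case: cid => f /= ->.
Qed.

Lemma ultra_pi_eqP (f g : T -> M) :
  ultra_pi f = ultra_pi g <-> \forall t \near G, f t = g t.
Proof.
split=> [[fg]|fg].
  have : ultra_class g g by apply: nearW.
  by rewrite -fg.
apply: eq_sig_hprop => [A|]; first exact: Prop_irrelevance.
apply/seteqP; split=> h /= H.
  by apply: filterS2 fg H => t -> ->.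
by apply: filterS2 fg H => t -> ->.
Qed.

Lemma ultra_piK (f : T -> M) :
  \forall t \near G, ultra_repr (ultra_pi f) t = f t.
Proof. by apply/ultra_pi_eqP; rewrite ultra_reprK. Qed.

(** Finitely many large sets have a large intersection; this serves the arguments of a symbol, whose
    arity is finite. *)
Lemma ultra_piK_fin (I : finType) (f : I -> T -> M) :
  \forall t \near G,
    (fun i => ultra_repr (ultra_pi (f i)) t) = (fun i => f i t).
Proof.
have H : \forall t \near G, forall i, ultra_repr (ultra_pi (f i)) t = f i t.
  by apply: filter_forall => i; apply: ultra_piK.
by apply: filterS H => t Ht; apply/funext.
Qed.

Lemma ultra_eval (V : Type) (w : V -> T -> M) (s : term L V) :
  eval (M := ultrapower) (fun x => ultra_pi (w x)) s =
  ultra_pi (fun t => eval (fun x => w x t) s).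
Proof.
elim: s => [//|f args IH] /=.
apply/ultra_pi_eqP.
have := ultra_piK_fin (fun i t => eval (fun x => w x t) (args i)).
by apply: filterS => t <-; congr fun_interp; apply/funext => i; rewrite IH.
Qed.

Lemma ultra_impl (P Q : T -> Prop) :
  (\forall t \near G, P t -> Q t) <->
  ((\forall t \near G, P t) -> \forall t \near G, Q t).
Proof.
split=> [PQ P'|PQ]; first by apply: filterS2 PQ P' => t; apply.
(* Maximality of the ultrafilter: if [P] is not large, its complement is, and there the implication
   is vacuous. *)
have [/PQ|] := in_ultra_setVsetC [set t | P t] GU.
  by apply: filterS.
by apply: filterS.
Qed.

Lemma los (V : Type) (phi : formula L V) (w : V -> T -> M) :
  sat (M := ultrapower) (fun x => ultra_pi (w x)) phi <->
  \forall t \near G, sat (fun x => w x t) phi.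
Proof.
elim: phi w => {V} [V|V s u|V r args|V f IHf g IHg|V f IH] w /=.
- by split=> // /filter_ex [].
- by rewrite !ultra_eval ultra_pi_eqP.
- have E : \forall t \near G,
      (fun i => ultra_repr (eval (M := ultrapower) (fun x => ultra_pi (w x))
        (args i)) t) = (fun i => eval (fun x => w x t) (args i)).
    have := ultra_piK_fin (fun i t => eval (fun x => w x t) (args i)).
    by apply: filterS => t <-; apply/funext => i; rewrite ultra_eval.
  by split=> H; apply: filterS2 E H => t ->.
- by rewrite IHf IHg -ultra_impl.
have extE (h : T -> M) :
    (fun o => oapp (fun x => ultra_pi (w x)) (ultra_pi h) o) =
    (fun o => ultra_pi (oapp w h o)).
  by apply/funext; case.
have extE' h t : (fun o => oapp w h o t) = oapp (w ^~ t) (h t).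
  by apply/funext; case.
split=> [H|H x].
  have [//|nH] := in_ultra_setVsetC
    [set t | forall x, sat (oapp (w ^~ t) x) f] GU.
  (* The point [x0] only serves as a default value for [h]. *)
  have /filter_ex [t0 /existsNP [x0 _]] := nH.
  (* [h] picks a counterexample at each [t] that has one, so truth at [h t] forces truth at every
     [x]. *)
  have /choice [h hP] t : exists y,
      sat (oapp (w ^~ t) y) f -> forall x, sat (oapp (w ^~ t) x) f.
    have [a|/existsNP [y ny]] := pselect (forall x, sat (oapp (w ^~ t) x) f).
      by exists x0.
    by exists y.
  have := H (ultra_pi h); rewrite extE IH.
  by apply: filterS => t; rewrite extE'; apply: hP.
rewrite -(ultra_reprK x) extE IH.
by apply: filterS H => t; rewrite extE'; apply.
Qed.

End Ultrapower.

(** Compactness by an ultrapower: its coordinate [m] carries the pattern of size [m], and a fixed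
    tuple [i] fits into all but finitely many of these patterns. *)
Lemma finite_patterns_has_IP (L : language) (M : structure L) (n : nat)
    (d : 'I_n -> nat) (e : nat) (psi : formula L (block_var d e)) :
  (forall m : nat, exists (a : forall j : 'I_n, nat -> 'I_(d j) -> M)
      (b : set ('I_n -> nat) -> 'I_e -> M),
    forall (I : set ('I_n -> nat)) (i : 'I_n -> nat), (forall j, i j < m)%N ->
      sat (block_assign (fun j => a j (i j)) (b I)) psi <-> I i) ->
  has_IP (complete_theory M) psi.
Proof.
move=> /choice [a /choice [b abP]].
(* Refining the eventual filter makes every cofinite set large. *)
have [G [GU evG]] := ultraFilterLemma eventually_filter.
have GP := ultra_proper.
exists (ultrapower M G); split.
  move=> phi Mphi; rewrite /holds.
  have := los GU phi (fun x : void => match x return nat -> M with end).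
  set v := (X in sat X phi).
  set v' := (X in _ <-> \forall t \near _, sat (X t) phi).
  have -> : v = (fun x => match x return ultrapower M G with end).
    by apply/funext; case.
  move=> ->; apply: nearW => t.
  suff -> : v' t = (fun x : void => match x return M with end) by [].
  by apply/funext; case.
exists (fun j i k => ultra_pi G (fun m => a m j i k)).
exists (fun I k => ultra_pi G (fun m => b m I k)) => I i.
have large : \forall m \near G, forall j, (i j < m)%N.
  apply: filter_forall => j; apply: evG; by exists (i j).+1.
set v := (X in sat X psi).
have -> : v = (fun x => ultra_pi G (fun m =>
    block_assign (fun j => a m j (i j)) (b m I) x)).
  by apply/funext => -[u|k].
rewrite los; split=> [H|Ii].
  have /filter_ex [m [im]] : \forall m \near G, (forall j, i j < m)%N /\
      sat (block_assign (fun j => a m j (i j)) (b m I)) psi.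
    by apply: filterS2 large H.
  by rewrite abP.
by apply: filterS large => m im; apply/abP.
Qed.

(** * The additive group of the values of [x ^+ p - x] *)

Section ArtinSchreierMap.
Variables (K : fieldType) (p : nat).
Hypothesis pcharK : p \in [pchar K].

Definition AS_image : set K := [set x ^+ p - x | x in [set: K]].

Lemma AS_image0 : AS_image 0.
Proof.
exists 0 => //.
by rewrite subr0 expr0n gtn_eqF // prime_gt0 // (pcharf_prime pcharK).
Qed.

Lemma AS_imageB (x y : K) : AS_image x -> AS_image y -> AS_image (x - y).
Proof.
move=> [u _ <-] [v _ <-]; exists (u - v) => //.
by rewrite -!(pFrobenius_autE pcharK) rmorphB /= !opprD addrACA.
Qed.

Lemma AS_imageD (x y : K) : AS_image x -> AS_image y -> AS_image (x + y).
Proof.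
move=> Ax Ay; rewrite -[y]opprK; apply: AS_imageB => //.
by rewrite -sub0r; apply: AS_imageB => //; exact: AS_image0.
Qed.

Lemma AS_image_sum (I : finType) (f : I -> K) :
  (forall i, AS_image (f i)) -> AS_image (\sum_i f i).
Proof.
by move=> Af; elim/big_ind: _ => //; [exact: AS_image0|exact: AS_imageD].
Qed.

(** The difference telescopes into the values at [x ^+ (p ^ i)], [i < k]. *)
Lemma AS_image_Frobenius (k : nat) (x : K) : AS_image (x ^+ (p ^ k) - x).
Proof.
elim: k => [|k IH]; first by rewrite expr1 subrr; exact: AS_image0.
rewrite -(subrKA (x ^+ (p ^ k))); apply: AS_imageD IH.
by exists (x ^+ (p ^ k)) => //; rewrite expnSr exprM.
Qed.

Lemma infinite_nonroot (q : {poly K}) :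
  infinite_set [set: K] -> q != 0 -> exists x, q.[x] != 0.
Proof.
move=> Kinf q0; apply: contrapT => /forallNP roots.
have [B _ sB] := infinite_set_fset (size q) Kinf.
have := max_poly_roots q0 _ (finmap.fset_uniq B).
rewrite ltnNge sB => /(_ _)/negP[] //.
by apply/allP => x _; apply/negPn/negP; apply: roots.
Qed.

(** The order of quantifiers matters: a single [g] serves all targets [r], so it can give the
    parameters [a], which may not depend on the subset to be cut out. *)
Lemma AS_interpolation (D : nat) : infinite_set [set: K] ->
  exists g : K, forall r : 'I_D -> K, exists t : K,
    forall i : 'I_D, AS_image (g ^+ i * t - r i).
Proof.
move=> Kinf.
(* The Vandermonde determinant of the powers ['X^(p ^ j)]; a non-root [c] has distinct
   conjugates. *)
pose q : {poly K} :=
  \prod_(j < D) \prod_(k < D | (j < k)%N) ('X^(p ^ k) - 'X^(p ^ j)).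
have q0 : q != 0.
  apply/prodf_neq0 => j _; apply/prodf_neq0 => k jk.
  rewrite subr_eq0; apply/eqP => /(congr1 (fun f : {poly K} => size f)).
  rewrite !size_polyXn => -[/eqP].
  by rewrite eqn_exp2l ?prime_gt1 ?(pcharf_prime pcharK) // gtn_eqF.
have [c qc] := infinite_nonroot Kinf q0.
pose V := Vandermonde D (\row_(j < D) c ^+ (p ^ j)).
have Vunit : V \in unitmx.
  rewrite unitmxE det_Vandermonde unitfE; move: qc.
  rewrite horner_prod; under eq_bigr do rewrite horner_prod.
  under eq_bigr do under eq_bigr do rewrite !hornerE.
  by under [X in _ -> X != 0]eq_bigr do under eq_bigr do rewrite !mxE.
exists (c ^+ (p ^ D)) => r.
pose e := invmx V *m \col_i r i.
have Ve (i : 'I_D) : \sum_(j < D) c ^+ (p ^ j) ^+ i * e j 0 = r i.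
  have /matrixP/(_ i 0) := mulKVmx Vunit (\col_i r i).
  rewrite mxE [in RHS]mxE => <-.
  by apply: eq_bigr => j _; rewrite !mxE.
(* The exponent [D - j] complements [p ^ j] to [p ^ D], which makes each summand of [g ^+ i * t] a
   [p ^ (D - j)]-th power. *)
exists (\sum_(j < D) e j 0 ^+ (p ^ (D - j))) => i.
rewrite -Ve mulr_sumr -sumrB; apply: AS_image_sum => j.
have -> : c ^+ (p ^ D) ^+ i * e j 0 ^+ (p ^ (D - j)) =
    (c ^+ (p ^ j) ^+ i * e j 0) ^+ (p ^ (D - j)).
  rewrite exprMn -!exprM; congr (_ ^+ _ * _).
  by rewrite mulnAC -expnD subnKC // ltnW.
exact: AS_image_Frobenius.
Qed.

End ArtinSchreierMap.

(** * From surjectivity of [x ^+ p - x] to Artin-Schreier closedness *)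

Lemma pcharf_expr_fixed (F : fieldType) (p : nat) (x : F) :
  p \in [pchar F] -> x ^+ p = x -> exists k : nat, x = k%:R.
Proof.
move=> pF xp; have p_pr := pcharf_prime pF.
apply: contrapT => /forallNP nx.
(* These [p] elements of the prime field already exhaust the roots of ['X^p - 'X]; [x] would be one
   too many. *)
pose rs := [seq k%:R : F | k <- iota 0 p].
have q_size : size ('X^p - 'X : {poly F}) = p.+1.
  by rewrite size_polyDl size_polyXn // size_polyN size_polyX ltnS prime_gt1.
have rs_uniq : uniq (x :: rs).
  rewrite cons_uniq; apply/andP; split; first by apply/mapP => -[k _ /nx].
  rewrite map_inj_in_uniq ?iota_uniq // => i j.
  rewrite !mem_iota /= !add0n.
  wlog le_ij : i j / (i <= j)%N.
    move=> W ip jp ij; case/orP: (leq_total i j) => H; first exact: W.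
    by apply/esym/W.
  move=> ip jp ij.
  have : (p %| j - i)%N by rewrite (dvdn_pcharf pF) natrB // ij subrr.
  rewrite /dvdn modn_small ?(leq_ltn_trans (leq_subr _ _)) // subn_eq0 => ji.
  by apply/eqP; rewrite eqn_leq le_ij ji.
have rs_roots : all (root ('X^p - 'X)) (x :: rs).
  rewrite /= /root !hornerE xp subrr eqxx /=.
  apply/allP => _ /mapP [k _ ->]; rewrite !hornerE.
  by rewrite -(pFrobenius_autE pF) rmorph_nat subrr.
have q0 : 'X^p - 'X != 0 :> {poly F} by rewrite -size_poly_eq0 q_size.
have := max_poly_roots q0 rs_roots rs_uniq.
by rewrite q_size /= size_map size_iota ltnn.
Qed.

Lemma AS_surjective_closed (K : fieldType) :
  (forall p : nat, p \in [pchar K] -> @AS_image K p = [set: K]) ->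
  artin_schreier_closed K.
Proof.
move=> surj p pK E a /vlineP [y ay].
have pE : p \in [pchar E] by rewrite (fmorph_pchar (GRing.in_alg E)).
have [x _ xy] : @AS_image K p y by rewrite surj.
(* Both [a] and [x] are sent to [y] by the additive map [z ^+ p - z], so their difference is fixed
   by Frobenius. *)
have [k /eqP] : exists k : nat, a - x%:A = k%:R.
  have ap : a ^+ p = x%:A ^+ p - x%:A + a.
    rewrite -[LHS](subrK a) ay -xy scalerBl.
    by rewrite -(rmorphXn (GRing.in_alg E)).
  apply: (pcharf_expr_fixed pE); rewrite -(pFrobenius_autE pE) rmorphB /=.
  by rewrite !pFrobenius_autE ap addrC addrA addKr addrC.
rewrite subr_eq => /eqP ->.
apply/Fadjoin_idP; rewrite rpredD ?rpred_nat //.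
by apply/vlineP; exists x.
Qed.

(** * Coding tuples by base [m] digits *)

Lemma digits_ltn (n m : nat) (i : 'I_n -> nat) :
  (forall j, i j < m)%N -> (\sum_(j < n) i j * m ^ j < m ^ n)%N.
Proof.
elim: n i => [|n IH] i im; first by rewrite big_ord0.
have m0 : (0 < m)%N by apply: leq_trans (im ord0).
rewrite big_ord_recr /= expnS.
apply: leq_trans (_ : (m ^ n + i ord_max * m ^ n <= _)%N).
  by rewrite ltn_add2r; apply: IH.
by rewrite -mulSn leq_mul2r im orbT.
Qed.

Lemma digits_inj (n m : nat) (i i' : 'I_n -> nat) :
  (forall j, i j < m)%N -> (forall j, i' j < m)%N ->
  (\sum_(j < n) i j * m ^ j = \sum_(j < n) i' j * m ^ j)%N -> i = i'.
Proof.
elim: n i i' => [|n IH] i i' im im' E; first by apply/funext => -[].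
have m0 : (0 < m)%N by apply: leq_trans (im ord0).
have ltS k : (forall j, k j < m)%N -> 
    (\sum_(j < n) k (widen_ord (leqnSn n) j) * m ^ j < m ^ n)%N.
  by move=> km; apply: digits_ltn.
move: E; rewrite !big_ord_recr /= => E.
(* The leading digit is the quotient by [m ^ n], since the lower digits sum to less than that;
   induction treats the others. *)
have Emax : i ord_max = i' ord_max.
  have := congr1 (fun k => k %/ m ^ n)%N E.
  have quo b k : (b < m ^ n)%N -> ((b + k * m ^ n) %/ m ^ n = k)%N.
    by move=> lt_b; rewrite addnC divnMDl ?expn_gt0 ?m0 // divn_small ?addn0.
  by rewrite /= !quo ?ltS.
move: E; rewrite Emax => /addIn /IH E.
apply/funext => j; have [->//|jn] := eqVneq j ord_max.
have lt_jn : (j < n)%N by rewrite ltn_neqAle -ltnS ltn_ord andbT.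
rewrite (_ : j = widen_ord (leqnSn n) (Ordinal lt_jn)); last exact: val_inj.
exact: (congr1 (fun f => f (Ordinal lt_jn)) (E _ _)).
Qed.

(** * The formula with the independence property *)

Section RingTerms.
Variables (K : fieldType) (L : language) (S : interpretation L K).

Local Notation M := (field_structure S).
Local Notation term := (term (lang_sum ring_language L)).

Definition term_one (V : Type) : term V :=
  App (L := lang_sum ring_language L) (f := inl ROne)
    (fun i : 'I_0 => match notF (ltn_ord i) with end).

(** With [f] a variable the arity is not known to be 2, so the arguments are told apart by the value
    of the index. *)
Definition term_binary (V : Type) (f : ring_fsym) (s t : term V) : term V :=
  App (L := lang_sum ring_language L) (f := inl f)
    (fun i => if val i is 0 then s else t).

Definition term_prod (V : Type) (ts : seq (term V)) : term V :=
  foldr (term_binary RMul) (term_one V) ts.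

Lemma eval_term_add (V : Type) (v : V -> M) (s t : term V) :
  eval v (term_binary RAdd s t) = (eval v s : K) + eval v t.
Proof. by []. Qed.

Lemma eval_term_prod (V : Type) (v : V -> M) (ts : seq (term V)) :
  eval v (term_prod ts) = \prod_(t <- ts) (eval v t : K).
Proof.
elim: ts => [|t ts IH]; first by rewrite big_nil.
by rewrite big_cons -IH.
Qed.

Variables (p n : nat).

Local Notation y_var j := (existT (fun _ : 'I_n => 'I_1) j ord0).

(* y_0 * ... * y_(n-1) * x is not of the form z ^+ p - z. *)
Definition AS_formula :
    formula (lang_sum ring_language L) (block_var (fun _ : 'I_n => 1%N) 1) :=
  Forall (Defs.Implies
    (Equal (term_prod (nseq p (Var _ None)))
       (term_binary RAdd
          (term_prod (Var _ (Some (inr ord0)) ::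
             [seq Var _ (Some (inl (y_var j))) | j <- enum 'I_n]))
          (Var _ None)))
    (Falsum _ _)).

Lemma sat_AS_formula (v : block_var (fun _ : 'I_n => 1%N) 1 -> M) :
  sat v AS_formula <->
  ~ @AS_image K p
      ((\prod_(j < n) (v (inl (y_var j)) : K)) * v (inr ord0)).
Proof.
have eval_lhs (z : K) : eval (M := M) (fun o => oapp v z o)
    (term_prod (nseq p (Var _ None))) = z ^+ p.
  by rewrite eval_term_prod big_nseq iter_mulr_1.
rewrite /AS_formula /sat -/sat; split=> [nz [z _ zE]|nz z].
  apply: (nz z); rewrite eval_lhs eval_term_add eval_term_prod big_cons big_map.
  by rewrite big_enum /= mulrC -zE subrK.
rewrite eval_lhs eval_term_add eval_term_prod big_cons big_map.
rewrite big_enum /= => zE.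
by apply: nz; exists z => //; rewrite zE addrK mulrC.
Qed.

Lemma AS_formula_has_IP : p \in [pchar K] -> infinite_set [set: K] ->
  @AS_image K p <> [set: K] -> has_IP (complete_theory M) AS_formula.
Proof.
move=> pK Kinf nsurj.
have [w nw] : exists w, ~ @AS_image K p w.
  apply: contrapT => /forallNP W; apply: nsurj.
  by apply/seteqP; split=> // w _; apply: contrapT; apply: W.
apply: finite_patterns_has_IP => m.
have [g gP] := AS_interpolation pK (m ^ n) Kinf.
have /choice [t tP] (I : set ('I_n -> nat)) : exists t : K,
    forall i : 'I_n -> nat, (forall j, i j < m)%N ->
      ~ @AS_image K p (g ^+ (\sum_(j < n) i j * m ^ j) * t) <-> I i.
  (* The target is [w] at the codes of tuples in [I] and 0 elsewhere. *)
  pose r (k : 'I_(m ^ n)) : K :=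
    if `[< exists i : 'I_n -> nat, [/\ forall j, (i j < m)%N, I i &
           (\sum_(j < n) i j * m ^ j)%N = k] >] then w else 0.
  have [t tP] := gP r.
  exists t => i im; have := tP (Ordinal (digits_ltn im)); rewrite /r /=.
  case: asboolP => [[i' [i'm Ii' /(digits_inj i'm im) <-]] At|nI].
    split=> // _ Agt; apply: nw.
    (* Were [g ^+ _ * t] in the image, so would be [w], since they differ by an element of it. *)
    rewrite -[w](subKr (g ^+ (\sum_(j < n) i' j * m ^ j) * t)).
    exact: AS_imageB.
  rewrite subr0 => At; split=> [//|Ii]; case: nI.
  by exists i.
(* Digit [k] in position [j] contributes the factor [g ^+ (k * m ^ j)], so the product over [j] is
   [g] to the code of the tuple. *)
exists (fun j k _ => g ^+ (k * m ^ j)), (fun I _ => t I) => I i im.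
rewrite sat_AS_formula -(tP I i im) /=.
by rewrite prodrXr.
Qed.

End RingTerms.

Unset Implicit Arguments.

Theorem theorem6p3 (n : nat) (hn : (1 <= n)%N) (K : fieldType)
    (L : language) (S : interpretation L K)
    (hinf : infinite_set [set: K])
    (hdep : n_dependent n (field_structure S)) :
  artin_schreier_closed K /\
  (forall p : nat, p \in [pchar K] ->
    [set x ^+ p - x | x in [set: K]] = [set: K]).
Proof.
have surj p : p \in [pchar K] -> @AS_image K p = [set: K].
  move=> pK; apply: contrapT => /(AS_formula_has_IP S n pK hinf).
  exact: hdep.
by split; first exact: AS_surjective_closed.
Qed.
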